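(* Let $t$ be a positive integer. (1) Let $D$ be a (fixed) set of positive integers with $|D| = t$. If $D \ne \{2, 4, \dots, 2t\}$, then as $n \to \infty$ we have $$A(\mathcal{H}_n, D) \le \left(\frac{t}{t+1} + o(1)\right) \cdot \binom{n}{t}.$$ (2) When $n \ge 2t + 2$, we have $$A(\mathcal{H}_n, \{2, 4, \dots, 2t\}) = \begin{cases} \binom{n}{0} + \binom{n}{2} + \dots + \binom{n}{t-2} + \binom{n}{t} & \text{if } t \text{ is even}, \\ \binom{n}{1} + \binom{n}{3} + \dots + \binom{n}{t-2} + \binom{n}{t} & \text{if } t \text{ is odd}. \end{cases}$$ That is, the right-hand side is the sum of $\binom{n}{i}$ over all integers $0 \le i \le t$ with $i \equiv t \pmod 2$.
   Context: $\mathcal{H}_n$ is the set $\mathbb{F}_2^n$ of binary strings of length $n$ endowed with the Hamming distance: $\mathrm{dist}_{\mathcal{H}_n}(\boldsymbol{x}, \boldsymbol{y})$ is the number of coordinates in which $\boldsymbol{x}$ and $\boldsymbol{y}$ differ. For $X \subseteq \mathcal{H}_n$, its distance set is $D(X) = \{\mathrm{dist}_{\mathcal{H}_n}(\boldsymbol{x}, \boldsymbol{y}) : \boldsymbol{x}, \boldsymbol{y} \in X, \ \boldsymbol{x} \ne \boldsymbol{y}\}$. For a finite set $D$ of positive integers, $A(\mathcal{H}_n, D) = \max\{ |X| : X \subseteq \mathcal{H}_n, \ D(X) = D \}$, interpreted as $0$ if no such $X$ exists. The quantity $o(1)$ tends to $0$ as $n \to \infty$ with $D$ (hence $t$) fixed.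 *)

(* Defs.v *)
From HB Require Import structures.
From mathcomp Require Import all_boot all_order all_algebra.
From mathcomp Require Import finmap.

Set Implicit Arguments.
Unset Strict Implicit.
Unset Printing Implicit Defensive.

Local Open Scope ring_scope.

Definition hdist (n : nat) (x y : 'rV['F_2]_n) : nat :=
  #|[set i : 'I_n | x 0 i != y 0 i]|.

Definition dist_set (n : nat) (X : {set 'rV['F_2]_n}) : {fset nat} :=
  [fset hdist x y | x in X, y in X & x != y]%fset.

(* The maximum over an empty family is 0. *)
Definition max_code (n : nat) (D : {fset nat}) : nat :=
  \max_(X : {set 'rV['F_2]_n} | dist_set X == D) #|X|.

Definition even_dists (t : nat) : {fset nat} :=
  [fset (2 * i)%N | i in iota 1 t]%fset.

(* Main.v *)
Require Import Defs.
From HB Require Import structures.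
From mathcomp Require Import all_boot all_order all_algebra.
From mathcomp Require Import perm finmap zify ring.

Set Implicit Arguments.
Unset Strict Implicit.
Unset Printing Implicit Defensive.

(** Binary strings are identified with their supports, so that the objects of
study are families of finite sets under the size of the symmetric difference.

Upper bound for [D] other than [2, 4, .., 2t].  Splitting a family by the parity
of the sizes makes all distances even; if [D] has an odd element, each class
has at most [t - 1] distances and size [O(n ^ (t - 1))].  So let
[D = 2 b_1, .., 2 b_t], with largest element [2r].  Any subfamily of diameter
less than [2r] has one distance less, hence size [O(n ^ (t - 1))].  A family of
larger order contains sunflower-like configurations with petals of size [r]
([kernel_exists]), whose kernel is the center of a ball of radius [r] containing
the whole family ([center_of_large]).  Take the center as origin: almost
all members have size [r], and those through a fixed point share it, so they
avoid the distance [2r].  Counting incidences with points gives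
[r |X| <= n * (bound for t - 1)] ([card_in_ball]), and by induction
[|X| <= n ^ t / (b_1 .. b_t) + O(n ^ (t - 1))] ([card_half_dists]).  Distinct
positive integers [b_i] other than [1, .., t] have product at least
[(t + 1) / t * t!] ([prod_decreasing_gap]), whence the constant [t / (t + 1)].

Value for [2, 4, .., 2t].  Deleting a coordinate turns the upper bound into
Kleitman's theorem on families of diameter [2t] ([kleitman]).  That theorem is
proved by compression: a family of least weight among those of its size and
diameter is closed under removing points and under exchanging a point [v] for
another one, which lowers the diameter by two on the members containing [v]
([compressed_star_diam]); induction on the dimension and Pascal's rule finish.
The layers of sizes [t, t - 2, ..] attain the bound. *)

(** * Symmetric difference distance *)

Definition symdiff (T : finType) (x y : {set T}) : {set T} :=
  [set i | (i \in x) (+) (i \in y)].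

Definition sdist (T : finType) (x y : {set T}) : nat := #|symdiff x y|.

Section Distance.
Variable T : finType.
Implicit Types x y z : {set T}.

Lemma symdiffC x y : symdiff x y = symdiff y x.
Proof. by apply/setP=> i; rewrite !inE addbC. Qed.

Lemma symdiff_cancel c : cancel (symdiff c) (@symdiff T c).
Proof. by move=> x; apply/setP=> i; rewrite !inE addKb. Qed.

Lemma symdiffxx x : symdiff x x = set0.
Proof. by apply/setP=> i; rewrite !inE addbb. Qed.

Lemma symdiff0 x : symdiff set0 x = x.
Proof. by apply/setP=> i; rewrite !inE. Qed.

Lemma sdistxx x : sdist x x = 0.
Proof. by rewrite /sdist symdiffxx cards0. Qed.

Lemma sdist_gt0 x y : x != y -> 0 < sdist x y.
Proof.
apply: contra_neqT; rewrite -eqn0Ngt cards_eq0 => /eqP/setP xy.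
apply/setP=> i; move/(_ i): xy; rewrite !inE => /addbP.
by case: (i \in x); case: (i \in y).
Qed.

Lemma sdistC x y : sdist x y = sdist y x.
Proof. by rewrite /sdist symdiffC. Qed.

Lemma sdist_translate c x y : sdist (symdiff c x) (symdiff c y) = sdist x y.
Proof.
apply: eq_card => i; rewrite !inE.
by case: (i \in c); case: (i \in x); case: (i \in y).
Qed.

Lemma sdist0 x : sdist set0 x = #|x|.
Proof. by rewrite /sdist symdiff0. Qed.

Lemma sdistD x y : sdist x y + (#|x :&: y|).*2 = #|x| + #|y|.
Proof.
rewrite /sdist; have -> : symdiff x y = (x :|: y) :\: (x :&: y).
  by apply/setP=> i; rewrite !inE; case: (i \in x); case: (i \in y).
have := cardsID (x :&: y) (x :|: y).
have -> : (x :|: y) :&: (x :&: y) = x :&: y.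
  by apply/setP=> i; rewrite !inE; case: (i \in x); case: (i \in y).
have := cardsUI x y; lia.
Qed.

End Distance.

Lemma sdist_setD1 (T : finType) (v : T) (x y : {set T}) :
  sdist (x :\ v) (y :\ v) <= sdist x y <= (sdist (x :\ v) (y :\ v)).+1.
Proof.
have -> : sdist x y = (v \in symdiff x y) + sdist (x :\ v) (y :\ v).
  rewrite /sdist (cardsD1 v); congr (_ + _); apply: eq_card => i.
  by rewrite !inE; case: (i == v).
by case: (v \in _); rewrite ?add0n ?add1n ?leqnn ?leqnSn.
Qed.

(** * Kernels and centers of bounded families *)

Definition star (T : finType) (F : {set {set T}}) (A : {set T}) :=
  [set f in F | A \subset f].

(** A weak sunflower lemma: [A] plays the part of a sunflower kernel, the
petals [f :\: A] being rich enough to avoid any prescribed set [W] of [q]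
points.  If the current [A] fails because of some [W], every member of its
star meets [W :\: A], so one of at most [q] points can be added to [A] at the
cost of a factor [q] in the size of the star; this happens at most [k]
times. *)
Lemma kernel_exists (T : finType) (F : {set {set T}}) (k q : nat) :
    0 < q -> F != set0 -> (forall f, f \in F -> #|f| <= k) ->
  exists A : {set T}, #|F| <= q ^ k * #|star F A| /\
    forall W : {set T}, #|W| <= q ->
      exists2 f, f \in star F A & [disjoint f :\: A & W].
Proof.
move=> q_gt0 F_neq0 Fk.
suff main j (A : {set T}) : k - #|A| <= j -> star F A != set0 ->
    exists A' : {set T}, #|star F A| <= q ^ j * #|star F A'| /\
    forall W : {set T}, #|W| <= q ->
      exists2 f, f \in star F A' & [disjoint f :\: A' & W].
  have F0 : star F set0 = F.
    by apply/setP=> f; rewrite inE sub0set andbT.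
  have := main k set0; rewrite F0 cards0 subn0; exact.
elim: j A => [|j IHj] A kA FA_neq0;
    have [good|] := boolP [forall W : {set T}, (#|W| <= q) ==>
      [exists f in star F A, [disjoint f :\: A & W]]].
- exists A; rewrite mul1n; split=> // W Wq.
  by move/forallP/(_ W): good; rewrite Wq => /exists_inP.
- case/forallPn=> W; rewrite negb_imply => /andP[_ /exists_inPn bad].
  have /set0Pn[f fA] := FA_neq0; have := bad _ fA.
  move: fA; rewrite inE => /andP[fF Af].
  have /eqP -> : A == f by rewrite eqEcard Af; have := Fk _ fF; lia.
  by rewrite setDv disjoints_subset sub0set.
- exists A; split=> [|W Wq]; first by rewrite leq_pmull // expn_gt0 q_gt0.
  by move/forallP/(_ W): good; rewrite Wq => /exists_inP.
case/forallPn=> W; rewrite negb_imply => /andP[Wq /exists_inPn bad].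
have cover : star F A \subset \bigcup_(v in W :\: A) star F (v |: A).
  apply/subsetP=> f fA; have := bad _ fA.
  rewrite disjoints_subset => /subsetPn[v]; rewrite !inE negbK.
  case/andP=> vA vf vW; apply/bigcupP; exists v; first by rewrite !inE vA.
  by move: fA; rewrite !inE => /andP[-> Af]; rewrite subUset sub1set vf.
have [v vW vmax] : exists2 v, v \in W :\: A &
    #|star F A| <= q * #|star F (v |: A)|.
  apply/exists_inP; apply: contraT => /exists_inPn small.
  have : #|star F A| <= \sum_(v in W :\: A) #|star F (v |: A)|.
    apply: leq_trans (subset_leq_card cover) _.
    elim/big_rec2: _ => [|v m U _ Um]; first by rewrite cards0.
    by have := cardsU (star F (v |: A)) U; lia.
  have /set0Pn[f fA] := FA_neq0.
  have [v0 v0W] : exists v, v \in W :\: A.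
    have := subsetP cover _ fA => /bigcupP[v vW _]; by exists v.
  have : q * \sum_(v in W :\: A) #|star F (v |: A)| < q * #|star F A|.
    rewrite big_distrr /=; apply: (@leq_trans (\sum_(v in W :\: A) #|star F A|)).
      rewrite (bigD1 v0) //= [X in _ < X](bigD1 v0) //= -addSn leq_add //.
        by rewrite ltnNge small.
      apply: leq_sum => v /andP[vW _]; rewrite ltnW // ltnNge; exact: small.
    rewrite sum_nat_const leq_mul2r (leq_trans (subset_leq_card _) Wq) ?orbT //.
    exact: subsetDl.
  by rewrite ltn_mul2l q_gt0 /=; lia.
have vA : #|v |: A| = #|A|.+1 by move: vW; rewrite cardsU1 !inE => /andP[-> _].
have [||A' [FA' good]] := IHj (v |: A).
- by lia.
- rewrite -card_gt0; move: FA_neq0; rewrite -card_gt0 => FA_gt0.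
  by move: (leq_trans FA_gt0 vmax); rewrite muln_gt0 => /andP[].
exists A'; split=> //; rewrite expnS -mulnA.
by apply: leq_trans vmax _; rewrite leq_mul2l FA' orbT.
Qed.

Definition diam_lt (T : finType) (m : nat) (X : {set {set T}}) :=
  {in X &, forall x y, sdist x y < m}.

(** If the family is large compared with its subfamilies of diameter less than
[2r], the center is a kernel [A] of a large layer, consisting of sets of size [d]
say.  Two members of the star meeting exactly in [A] are at distance
[2(d - #|A|)], so [d - #|A| <= r]; a strict inequality would give the star a
diameter less than [2r].  Hence all petals have size [r], and a petal disjoint
from a given [y] shows [r + sdist A y <= 2r]. *)
Lemma center_of_large (T : finType) (X : {set {set T}}) (r M : nat) :
    0 < r -> set0 \in X -> diam_lt r.*2.+1 X ->
    (forall Y : {set {set T}}, Y \subset X -> diam_lt r.*2 Y -> #|Y| <= M) ->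
  #|X| <= r.*2.+1 * (r.*2 ^ r.*2 * M) \/
  exists c, forall y, y \in X -> sdist c y <= r.
Proof.
move=> r_gt0 X0 Xdiam small.
have Xw x : x \in X -> #|x| <= r.*2.
  by move=> xX; rewrite -sdist0 -ltnS; apply: Xdiam.
pose layer (d : nat) := [set x in X | #|x| == d].
have [/forallP few|] :=
  boolP [forall d : 'I_r.*2.+1, #|layer d| <= r.*2 ^ r.*2 * M].
  left; rewrite -(card_ord r.*2.+1) -sum_nat_const.
  have -> : #|X| = \sum_(d < r.*2.+1) #|layer d|.
    rewrite -sum1_card (partition_big (fun x : {set T} => inord #|x| : 'I_r.*2.+1) predT) //=.
    apply: eq_bigr => d _; rewrite -sum1_card; apply: eq_bigl => x.
    rewrite inE; have [xX|] //= := boolP (x \in X).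
    by rewrite -val_eqE /= inordK // ltnS Xw.
  by apply: leq_sum => d _; apply: few.
case/forallPn=> d; rewrite -ltnNge => many; right.
have layer_w f : f \in layer d -> #|f| = d by rewrite inE => /andP[_ /eqP].
have [||f|A [cardA avoid]] := @kernel_exists T (layer d) r.*2 r.*2.
- by rewrite double_gt0.
- by rewrite -card_gt0; lia.
- by move/layer_w->; rewrite -ltnS.
have [f1 f1A _] := avoid set0 (leq_trans (eq_leq (cards0 _)) (leq0n _)).
have starX f : f \in star (layer d) A -> [/\ f \in X, #|f| = d & A \subset f].
  by rewrite !inE -andbA => /and3P[-> /eqP-> ->].
have [f1X f1d Af1] := starX _ f1A.
have Ad : #|A| <= d by rewrite -f1d subset_leq_card.
have [|f2 f2A dis12] := avoid f1; first exact: Xw.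
have [f2X f2d Af2] := starX _ f2A.
have A12 : f1 :&: f2 = A.
  apply/eqP; rewrite eqEsubset subsetI Af1 Af2 !andbT; apply/subsetP=> i.
  rewrite inE => /andP[i1 i2]; apply: contraT => iA.
  by have := disjointFr dis12 (x := i); rewrite !inE iA i2 i1 => /(_ isT).
(* the two petals [f1 :\: A] and [f2 :\: A] are disjoint *)
have upper : d - #|A| <= r.
  have := sdistD f1 f2; rewrite f1d f2d A12.
  by have := Xdiam _ _ f1X f2X; clear; lia.
(* any two members of the star already share [A] *)
have lower : r <= d - #|A|.
  rewrite leqNgt; apply/negP => dA; move: many; rewrite ltnNge => /negP; apply.
  apply: leq_trans cardA _; rewrite leq_mul2l small ?orbT //.
    by apply/subsetP=> f /starX[].
  move=> f g /starX[_ fd Af] /starX[_ gd Ag].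
  have := sdistD f g; rewrite fd gd.
  have : #|A| <= #|f :&: g| by rewrite subset_leq_card // subsetI Af.
  by move: dA; clear; lia.
exists A => y yX; have [|f fA disf] := avoid y; first exact: Xw.
have [fX fd Af] := starX _ fA.
have split_f : sdist f y = #|f :\: A| + sdist A y.
  rewrite /sdist -cardsUI [_ :&: _](_ : _ = set0) ?cards0 ?addn0.
    apply: eq_card => i; rewrite !inE.
    have := disjointFr disf (x := i); have := subsetP Af i; rewrite !inE.
    by case: (i \in A); case: (i \in f); case: (i \in y) => //= H1 H2;
    first [by have := H1 isT | by have := H2 isT].
  apply/setP=> i; rewrite !inE.
  have := disjointFr disf (x := i); have := subsetP Af i; rewrite !inE.
  by case: (i \in A); case: (i \in f); case: (i \in y) => //= H1 H2;
    first [by have := H1 isT | by have := H2 isT].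
have := Xdiam _ _ fX yX; rewrite split_f cardsD (setIidPr Af) fd.
by move: lower Ad; clear; lia.
Qed.

(** Inside a ball of radius [r], two sets have distance at least [2r] only if
they are disjoint and both of size [r].  So the sets of size less than [r] form
a family of diameter less than [2r], and so do the sets containing a given
point; counting incidences bounds the sets of size [r]. *)
Lemma card_in_ball (T : finType) (X : {set {set T}}) (r w M : nat) :
    (forall x, x \in X -> #|x| <= r) ->
    (forall Y : {set {set T}}, Y \subset X -> diam_lt r.*2 Y -> w * #|Y| <= M) ->
  r * (w * #|X|) <= (#|T| + r) * M.
Proof.
move=> Xr small.
pose X1 := [set x in X | #|x| == r]; pose X2 := [set x in X | #|x| < r].
have cardX : #|X| = #|X1| + #|X2|.
  rewrite -(cardsID X1 X); congr (_ + _); apply: eq_card => x; rewrite !inE.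
    by case: (x \in X).
  have [/Xr xr|] := boolP (x \in X); rewrite ?andbF //= andbT.
  by rewrite ltn_neqAle xr andbT.
have card2 : w * #|X2| <= M.
  apply: small; first by apply/subsetP=> x; rewrite inE => /andP[].
  move=> x y; rewrite !inE => /andP[_ xr] /andP[_ yr].
  by have := sdistD x y; lia.
have card1 : r * (w * #|X1|) <= #|T| * M.
  have -> : r * (w * #|X1|) = \sum_(v : T) w * #|[set x in X1 | v \in x]|.
    rewrite -big_distrr /= mulnCA; congr (_ * _).
    have degE v : #|[set x in X1 | v \in x]| = \sum_(x in X1) (v \in x).
      rewrite -sum1_card big_mkcond [RHS]big_mkcond /=.
      by apply: eq_bigr => x _; rewrite !inE; case: (_ && (_ == _)); case: (v \in x).
    under eq_bigr => v _ do rewrite degE.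
    rewrite exchange_big mulnC -sum_nat_const; apply: eq_bigr => x.
    rewrite inE => /andP[_ /eqP <-]; rewrite -sum1_card big_mkcond /=.
    by apply: eq_bigr => v _; case: (v \in x).
  rewrite -sum_nat_const; apply: leq_sum => v _; apply: small.
    by apply/subsetP=> x; rewrite !inE => /andP[/andP[]].
  move=> x y; rewrite !inE => /andP[/andP[_ /eqP xr] vx] /andP[/andP[_ /eqP yr] vy].
  have := sdistD x y; rewrite xr yr.
  have : 0 < #|x :&: y| by apply/card_gt0P; exists v; rewrite inE vx.
  by lia.
by rewrite cardX; nia.
Qed.

(** * Families with few even distances *)

(** Even distances are listed by their halves: the largest half is the radius
of the ball in which a large family must lie. *)
Definition half_dists (T : finType) (B : seq nat) (X : {set {set T}}) :=
  {in X &, forall x y, x != y -> sdist x y \in map double B}.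

Lemma half_dists_translate (T : finType) B (X : {set {set T}}) c :
  half_dists B X -> half_dists B (symdiff c @: X).
Proof.
move=> XB _ _ /imsetP[x xX ->] /imsetP[y yX ->] xy.
by rewrite sdist_translate XB //; apply: contraNneq xy => ->.
Qed.

Lemma card_translate (T : finType) (X : {set {set T}}) c :
  #|symdiff c @: X| = #|X|.
Proof. by rewrite card_imset //; apply: can_inj (@symdiff_cancel T c). Qed.

(** Let [r] be the largest half distance.  A subfamily of diameter less than [2r]
omits the distance [2r], so induction makes it of lower order.  A family with
more than a constant multiple of that many members has a center; in the ball
around it each of the [#|T|] families of sets through a given point omits the
distance [2r], and each set of size [r] has [r] points, which gives the new
factor [#|T| / r].  Both sides carry an extra factor [#|T|] so that the error
term has a natural exponent for the empty list of distances as well. *)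
Theorem card_half_dists (B : seq nat) :
    sorted gtn B -> all (leq 1) B ->
  exists C, forall (T : finType) (X : {set {set T}}), half_dists B X ->
    #|T| * (\prod_(b <- B) b) * #|X| <= #|T| ^ (size B).+1 + C * #|T| ^ size B.
Proof.
elim: B => [|r B IHB] /=.
  move=> _ _; exists 0 => T X XB; rewrite big_nil muln1 expn1 mul0n addn0.
  have : #|X| <= 1.
    apply/card_le1_eqP => x y xX yX; apply/eqP; apply: contraT => xy.
    by have := XB _ _ yX xX xy.
  by move=> X1; rewrite -[leqRHS]muln1 leq_mul2l X1 orbT.
move=> rB /andP[r_gt0 B_gt0]; have [C IH] := IHB (path_sorted rB) B_gt0.
set P := \prod_(b <- B) b in IH; set s := size B in IH *.
have P_gt0 : 0 < P by rewrite /P big_seq prodn_cond_gt0 // => b bB; exact: (allP B_gt0).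
have ltBr b : b \in B -> b < r.
  by move: rB; rewrite (path_sortedE (rev_trans ltn_trans)) => /andP[/allP/(_ b)].
pose K := r.*2.+1 * (r.*2 ^ r.*2 * C.+1).
exists (C + r + r * C + r * P * K) => T X XB.
rewrite big_cons -/P; set n := #|T|.
have [n0|n_gt0] := posnP n; first by rewrite n0.
have bounded (Y : {set {set T}}) : half_dists (r :: B) Y -> diam_lt r.*2.+1 Y.
  move=> YB x y xY yY; have [->|xy] := eqVneq x y.
    by rewrite sdistxx.
  have /mapP[b] := YB _ _ xY yY xy.
  by rewrite inE => /predU1P[->|/ltBr]; lia.
have drop (Y Z : {set {set T}}) : half_dists (r :: B) Y ->
    Z \subset Y -> diam_lt r.*2 Z -> half_dists B Z.
  move=> YB /subsetP ZY Zr x y xZ yZ xy.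
  have := YB _ _ (ZY _ xZ) (ZY _ yZ) xy; rewrite inE => /predU1P[E|//].
  by have := Zr _ _ xZ yZ; rewrite E ltnn.
have [->|/set0Pn[x0 x0X]] := eqVneq X set0; first by rewrite cards0 muln0.
have [||Y YX Yr|small|[c Xc]] :=
    @center_of_large T (symdiff x0 @: X) r (C.+1 * n ^ s) r_gt0.
- by apply/imsetP; exists x0; rewrite ?symdiffxx.
- exact/bounded/half_dists_translate.
- have := IH _ _ (drop _ _ (half_dists_translate (c := x0) XB) YX Yr).
  rewrite -/n => YP; rewrite -(leq_pmul2l n_gt0).
  apply: leq_trans (_ : n * P * #|Y| <= _).
    by rewrite -mulnA leq_mul2l leq_pmull ?orbT.
  by apply: leq_trans YP _; rewrite mulnCA -expnS mulSn leq_add2l leq_mul2l expnS leq_pmull ?orbT.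
- rewrite card_translate in small.
  apply: (@leq_trans (n * (r * P) * (K * n ^ s))).
    by rewrite leq_mul2l /K -!mulnA small orbT.
  rewrite (_ : _ * _ = r * P * K * n ^ s.+1); last by rewrite expnS; ring.
  by rewrite mulnDl addnA leq_addl.
have XcB := half_dists_translate (c := c) (half_dists_translate (c := x0) XB).
have ball : r * (n * P * #|symdiff c @: (symdiff x0 @: X)|) <=
    (n + r) * (n ^ s.+1 + C * n ^ s).
  apply: card_in_ball => [x|Y YX Yr]; last exact/IH/(drop _ _ XcB).
  by case/imsetP=> y yX ->; apply: Xc.
rewrite !card_translate in ball.
rewrite (_ : _ * #|X| = r * (n * P * #|X|)); last by ring.
apply: leq_trans ball _.
apply: (@leq_trans (n ^ s.+2 + (C + r + r * C) * n ^ s.+1)); last first.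
  by rewrite leq_add2l leq_mul2r leq_addr orbT.
rewrite !expnS; move: (n ^ s) => m.
have : r * C * m <= r * C * (n * m) by rewrite leq_mul2l leq_pmull ?orbT.
nia.
Qed.

(** * Compression and Kleitman's theorem *)

(** The mechanism common to removing a point and exchanging two points: an
isometric reflection [sigma] moves a half space [N] into its complement, getting
closer to the complement and decreasing a weight.  Replacing [x] by [sigma x]
whenever [sigma x] is not yet in the family keeps the size and the diameter
and lowers the total weight, so a family of least total weight contains all
these images. *)
Lemma compression_stable (T : finType) (X D : {set {set T}}) (m : nat)
    (sigma : {set T} -> {set T}) (N : pred {set T}) (w : {set T} -> nat) :
    involutive sigma ->
    (forall x y, sdist (sigma x) (sigma y) = sdist x y) ->
    (forall x y, N x -> ~~ N y -> sdist (sigma x) y <= sdist x y) ->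
    (forall x, N x -> w (sigma x) < w x) ->
    (forall x, x \in D -> N x -> sigma x \in D) ->
    X \subset D -> diam_lt m X ->
    (forall Y : {set {set T}}, #|Y| = #|X| -> Y \subset D -> diam_lt m Y ->
       \sum_(x in X) w x <= \sum_(y in Y) w y) ->
  forall x, x \in X -> N x -> sigma x \in X.
Proof.
move=> sigmaK iso towards wdrop stabD XD diamX minX x0 x0X Nx0.
apply: contraT => sx0.
pose moved x := N x && (sigma x \notin X).
pose c x := if moved x then sigma x else x.
have c_inj : {in X &, injective c}.
  rewrite /c => x y xX yX; case: ifP => mx; case: ifP => my //.
  - exact: (inv_inj sigmaK).
  - by move=> E; move: mx; rewrite /moved E yX andbF.
  - by move=> E; move: my; rewrite /moved -E xX andbF.
have := minX (c @: X); rewrite leqNgt big_imset //=.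
have -> : \sum_(x in X) w (c x) < \sum_(x in X) w x.
  rewrite (bigD1 x0) //= [ltnRHS](bigD1 x0) //= -addSn leq_add //.
    by rewrite /c /moved Nx0 sx0 wdrop.
  apply: leq_sum => x _; rewrite /c; case: ifP => // /andP[Nx _].
  exact/ltnW/wdrop.
apply; first exact: card_in_imset.
  apply/subsetP=> _ /imsetP[x /(subsetP XD) xD ->]; rewrite /c.
  by case: ifP => // /andP[Nx _]; apply: stabD.
have half x y : x \in X -> y \in X -> moved x -> ~~ moved y -> sdist (sigma x) y < m.
  move=> xX yX /andP[Nx _]; rewrite /moved negb_and negbK => /orP[Ny|syX].
    exact: leq_ltn_trans (towards _ _ Nx Ny) (diamX _ _ xX yX).
  by rewrite -(sigmaK y) iso; apply: diamX.
move=> _ _ /imsetP[x xX ->] /imsetP[y yX ->]; rewrite /c.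
case: ifPn => mx; case: ifPn => my.
- by rewrite iso; apply: diamX.
- exact: half.
- by rewrite sdistC; apply: half.
- exact: diamX.
Qed.

Definition swap (T : finType) (v i : T) (x : {set T}) : {set T} :=
  [set j | tperm v i j \in x].

Lemma swapK (T : finType) (v i : T) : involutive (swap v i).
Proof. by move=> x; apply/setP=> j; rewrite !inE tpermK. Qed.

Lemma sdist_swap (T : finType) (v i : T) x y :
  sdist (swap v i x) (swap v i y) = sdist x y.
Proof.
rewrite /sdist -(card_preimset (symdiff x y) (@perm_inj _ (tperm v i))).
by apply: eq_card => j; rewrite !inE.
Qed.

Definition compressed (T : finType) (S : {set T}) (v : T) (X : {set {set T}}) :=
  (forall x i, x \in X -> i \in x -> x :\ i \in X) /\
  (forall x i, x \in X -> v \in x -> i \in S -> i \notin x -> swap v i x \in X).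

(** The weight [#|x| + (v \in x)] decreases strictly both when a point is
removed and when [v] is exchanged for another point. *)
Lemma compress (T : finType) (S : {set T}) (v : T) (X : {set {set T}}) (m : nat) :
    v \in S -> X \subset powerset S -> diam_lt m X ->
  exists Y : {set {set T}}, [/\ #|Y| = #|X|, Y \subset powerset S, diam_lt m Y &
    compressed S v Y].
Proof.
move=> vS XS Xdiam.
pose w (x : {set T}) := #|x| + (v \in x).
pose P (Y : {set {set T}}) := [&& #|Y| == #|X|, Y \subset powerset S &
  [forall x in Y, [forall y in Y, sdist x y < m]]].
have PP (Y : {set {set T}}) :
    reflect [/\ #|Y| = #|X|, Y \subset powerset S & diam_lt m Y] (P Y).
  apply: (iffP and3P) => -[/eqP YX YS Yd]; split=> //.
    by move=> x y xY yY; move/forall_inP: Yd => /(_ _ xY)/forall_inP; apply.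
  by apply/forall_inP=> x xY; apply/forall_inP=> y yY; apply: Yd.
have PX : P X by apply/PP.
have [Y /PP[YX YS Yd] minY] := @arg_minnP _ X P (fun Y => \sum_(y in Y) w y) PX.
exists Y; split=> //; split=> [x i xY ix|x i xY vx iS ix].
  have -> : x :\ i = symdiff [set i] x.
    by apply/setP=> j; rewrite !inE; case: eqP => [->|]; rewrite ?ix.
  apply: (@compression_stable _ Y (powerset S) m _ (fun x => i \in x) w) => //.
  - exact: symdiff_cancel.
  - exact: sdist_translate.
  - move=> a b ia ib; apply/subset_leq_card/subsetP=> j; rewrite !inE.
    by case: eqP => [->|//]; rewrite ia (negPf ib).
  - move=> a ia; rewrite /w.
    have -> : symdiff [set i] a = a :\ i.
      by apply/setP=> j; rewrite !inE; case: eqP => [->|]; rewrite ?ia.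
    by rewrite [#|a|](cardsD1 i) ia !inE; case: (v \in a); case: (v == i); clear; lia.
  - move=> a; rewrite !inE => /subsetP aS ia; apply/subsetP=> j; rewrite !inE.
    by case: eqP => [->|_ /aS]; rewrite ?ia.
  - by move=> Z ZY ZS Zd; apply/minY/PP; split=> //; rewrite ZY.
apply: (@compression_stable _ Y (powerset S) m _ (fun x => (v \in x) && (i \notin x)) w) => //.
- exact: swapK.
- exact: sdist_swap.
- move=> a b /andP[va ia]; rewrite negb_and negbK => nb.
  have [vib|vib] := eqVneq (v \in b) (i \in b).
    rewrite -(sdist_swap v i a b) (_ : swap v i b = b) //.
    by apply/setP=> j; rewrite inE; case: tpermP => [->|->|].
  have [vb ib] : v \notin b /\ i \in b.
    by case: (v \in b) vib nb; case: (i \in b).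
  apply/subset_leq_card/subsetP=> j; rewrite !inE.
  by case: tpermP => [->|->|//]; rewrite ?va ?(negPf ia) ?(negPf vb) ?ib.
- move=> a /andP[va ia]; rewrite /w inE tpermL va (negPf ia) addn0 addn1 ltnS.
  by rewrite -[#|a|](card_preimset a (@perm_inj _ (tperm v i))) subset_leq_card.
- move=> a; rewrite !inE => /subsetP aS /andP[va ia]; apply/subsetP=> j; rewrite !inE.
  by case: tpermP => [-> //|-> //|_ _ /aS].
- by move=> Z ZY ZS Zd; apply/minY/PP; split=> //; rewrite ZY.
- by rewrite vx ix.
Qed.

Lemma compressed_down (T : finType) (S : {set T}) v (X : {set {set T}}) (x y : {set T}) :
  compressed S v X -> x \in X -> y \subset x -> y \in X.
Proof.
move=> [down _]; have [k] := ubnP #|x :\: y|; elim: k x => // k IHk x xk xX yx.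
have [|/set0Pn[i]] := eqVneq (x :\: y) set0.
  move/eqP; rewrite setD_eq0 => xy.
  by rewrite (_ : y = x) //; apply/eqP; rewrite eqEsubset yx.
rewrite inE => /andP[iy ix]; apply: (IHk (x :\ i)).
- have -> : (x :\ i) :\: y = (x :\: y) :\ i by apply/setP=> j; rewrite !inE andbCA.
  by move: xk; rewrite (cardsD1 i (x :\: y)) inE iy ix.
- exact: down.
- apply/subsetP=> j jy; rewrite !inE (subsetP yx) // andbT.
  by apply: contraNneq iy => <-.
Qed.

(** Let [x] and [y] contain [v].  Closure under subsets bounds [#|x :|: y|] by
the diameter of the family, so some point [i] of [S] lies outside both sets, and
exchanging [v] for [i] in [x] increases the distance to [y] by two. *)
Lemma compressed_star_diam (T : finType) (S : {set T}) v (X : {set {set T}}) m :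
    compressed S v X -> diam_lt m.+2 X -> m.+1 < #|S| ->
  diam_lt m [set x in X | v \in x].
Proof.
move=> cX dX mS x y; rewrite !inE => /andP[xX vx] /andP[yX vy].
have card_union : #|x :|: y| < #|S|.
  apply: leq_ltn_trans mS.
  (* [y :\: x] is a member as well, and is disjoint from [x] *)
  have -> : #|x :|: y| = sdist x (y :\: x).
    by apply: eq_card => j; rewrite !inE; case: (j \in x); case: (j \in y).
  by rewrite -ltnS; apply: dX => //; apply: compressed_down cX yX (subsetDl _ _).
have [i iS] : exists2 i, i \in S & i \notin x :|: y.
  by apply/subsetPn; apply: contraTN card_union => /subset_leq_card; rewrite -leqNgt.
rewrite inE negb_or => /andP[ix iy].
have := dX _ _ (cX.2 _ _ xX vx iS ix) yX.
have vi : v != i by apply: contraTneq vx => ->.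
have -> : sdist (swap v i x) y = (sdist x y).+2.
  rewrite /sdist (_ : symdiff (swap v i x) y = v |: (i |: symdiff x y)).
    by rewrite !cardsU1 !inE (negPf vi) vx vy (negPf ix) (negPf iy).
  apply/setP=> j; rewrite !inE; case: tpermP => [->|->|/eqP/negPf -> /eqP/negPf -> //].
    by rewrite (negPf ix) vy eqxx.
  by rewrite vx (negPf iy) eqxx orbT.
by rewrite !ltnS.
Qed.

Lemma card_subsets (T : finType) (S : {set T}) (p : pred nat) (t : nat) :
  #|[set A : {set T} | [&& A \subset S, p #|A| & #|A| <= t]]| =
    \sum_(0 <= i < t.+1 | p i) 'C(#|S|, i).
Proof.
rewrite big_mkord -sum1_card.
rewrite (partition_big (fun A : {set T} => inord #|A| : 'I_t.+1) (fun i => p i)) /=.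
  apply: eq_bigr => i pi; rewrite -cards_draws -sum1_card; apply: eq_bigl => A.
  rewrite !inE -!andbA; congr (_ && _).
  have [At|At] := leqP #|A| t; rewrite ?andbF -?val_eqE /= ?inordK //.
    by case: eqP => [->|]; rewrite ?pi ?andbF.
  by apply/esym/negbTE; rewrite neq_ltn orbC (leq_trans _ At).
by move=> A; rewrite inE => /and3P[_ pA At]; rewrite inordK.
Qed.

Lemma sum_binS (n t : nat) :
  \sum_(0 <= i < t.+2) 'C(n.+1, i) =
  \sum_(0 <= i < t.+1) 'C(n, i) + \sum_(0 <= i < t.+2) 'C(n, i).
Proof.
rewrite !(big_nat_recl t.+1) //= !bin0.
under eq_bigr do rewrite binS.
by rewrite big_split /= addnA addnC.
Qed.

(** Kleitman's diameter theorem.  For [#|S| = 2t + 1] no two members are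
complementary in [S], so replacing the large ones by their complements injects
the family into the ball of radius [t].  For larger [S], compress and split at
[v]: the part avoiding [v] has diameter at most [2t], the part containing [v] at
most [2t - 2], and Pascal's rule adds the two bounds. *)
Theorem kleitman (T : finType) (t : nat) (S : {set T}) (X : {set {set T}}) :
    X \subset powerset S -> diam_lt t.*2.+1 X -> t.*2 < #|S| ->
  #|X| <= \sum_(0 <= i < t.+1) 'C(#|S|, i).
Proof.
have [k] := ubnP #|S|; elim: k t S X => // k IHk t S X Sk XS dX tS.
case: t => [|t] in dX tS *.
  rewrite big_nat1 bin0; apply/card_le1_eqP=> x y xX yX.
  have := dX _ _ yX xX; rewrite ltnS leqn0 eqn0Ngt => xy0.
  by apply/eqP; apply: contraNT xy0 => /sdist_gt0.
have [tS2|tS2] := ltnP t.+1.*2.+1 #|S|; last first.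
  have cardS : #|S| = t.+1.*2.+1 by apply/eqP; rewrite eqn_leq tS2.
  pose f (x : {set T}) : {set T} := if #|x| <= t.+1 then x else S :\: x.
  have xS x : x \in X -> x \subset S by move/(subsetP XS); rewrite inE.
  have antipode x y : x \in X -> y \in X -> x <> S :\: y.
    move=> xX yX E; have := dX _ _ xX yX.
    suff -> : sdist x y = #|S| by rewrite cardS ltnn.
    apply: eq_card => i; rewrite E !inE.
    by have /subsetP/(_ i) := xS _ yX; case: (i \in y) => [->|]; rewrite ?addbF.
  have f_inj : {in X &, injective f}.
    rewrite /f => x y xX yX; case: ifP => _; case: ifP => _ // E.
    - by have := antipode _ _ xX yX.
    - by have := antipode _ _ yX xX (esym E).
    - have codiff z : z \in X -> S :\: (S :\: z) = z.
        by move=> zX; rewrite setDDr setDv set0U; apply/setIidPr/xS.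
      by rewrite -(codiff x) // E codiff.
  rewrite -(card_in_imset f_inj) -(card_subsets S predT).
  apply/subset_leq_card/subsetP=> _ /imsetP[x xX ->]; rewrite inE /f /=.
  case: leqP => xt; first by rewrite xS.
  rewrite subsetDl cardsD cardS (setIidPr (xS _ xX)) /=.
  by move: xt; clear; lia.
have /card_gt0P[v vS] : 0 < #|S| by apply: leq_trans tS2.
have [Y [<- YS dY cY]] := compress vS XS dX.
have cardS : #|S| = #|S :\ v|.+1 by rewrite (cardsD1 v) vS.
pose Y1 := [set x in Y | v \in x]; pose Y0 := [set x in Y | v \notin x].
have -> : #|Y| = #|Y1| + #|Y0|.
  by rewrite -(cardsID Y1 Y); congr (_ + _); apply: eq_card => x; rewrite !inE;
     case: (x \in Y); case: (v \in x).
have le0 : #|Y0| <= \sum_(0 <= i < t.+2) 'C(#|S :\ v|, i).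
  apply: IHk; last by lia.
  - by lia.
  - apply/subsetP=> x; rewrite !inE => /andP[/(subsetP YS)]; rewrite inE => xS vx.
    by rewrite subsetD1 xS.
  - by move=> x y; rewrite !inE => /andP[xY _] /andP[yY _]; apply: dY.
have le1 : #|Y1| <= \sum_(0 <= i < t.+1) 'C(#|S :\ v|, i).
  have d1 : diam_lt t.*2.+1 Y1.
    by apply: compressed_star_diam cY _ _; rewrite -?doubleS //; lia.
  have inj : {in Y1 &, injective (fun x => x :\ v)}.
    move=> x y; rewrite !inE => /andP[_ vx] /andP[_ vy] E.
    by rewrite -(setD1K vx) -(setD1K vy) E.
  rewrite -(card_in_imset inj); apply: IHk; last by lia.
  - by lia.
  - apply/subsetP=> _ /imsetP[x xY ->]; move: xY.
    rewrite !inE => /andP[/(subsetP YS)]; rewrite inE => xS _.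
    exact: setSD.
  - move=> _ _ /imsetP[x xY ->] /imsetP[y yY ->].
    have /andP[le _] := sdist_setD1 v x y.
    exact: leq_ltn_trans le (d1 _ _ xY yY).
by rewrite cardS sum_binS leq_add.
Qed.

(** * Codes as families of sets *)

Definition support (n : nat) (x : 'rV['F_2]_n) : {set 'I_n} :=
  [set i | x 0%R i != 0%R].

Definition char_row (n : nat) (A : {set 'I_n}) : 'rV['F_2]_n :=
  (\row_i (i \in A)%:R)%R.

Lemma support_char_row n : cancel (@char_row n) (@support n).
Proof. by move=> A; apply/setP=> i; rewrite inE mxE; case: (i \in A). Qed.

Lemma char_rowK n : cancel (@support n) (@char_row n).
Proof.
move=> x; apply/rowP=> i; rewrite mxE inE.
by case: (x 0%R i) => [[|[|//]] ltm]; apply: val_inj.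
Qed.

Lemma hdist_support n (x y : 'rV['F_2]_n) : hdist x y = sdist (support x) (support y).
Proof.
apply: eq_card => i; rewrite !inE.
by case: (x 0%R i) => [[|[|//]] ?]; case: (y 0%R i) => [[|[|//]] ?].
Qed.

Lemma max_code_le n (D : {fset nat}) (w M : nat) :
    (forall X : {set {set 'I_n}},
       {in X &, forall x y, x != y -> sdist x y \in D} -> w * #|X| <= M) ->
  w * max_code n D <= M.
Proof.
move=> bound; have [->//|w_gt0] := posnP w.
rewrite mulnC -leq_divRL //; apply/bigmax_leqP => X /eqP XD.
rewrite leq_divRL // mulnC -(card_imset X (can_inj (@char_rowK n))).
apply: bound => _ _ /imsetP[x xX ->] /imsetP[y yX ->] xy.
rewrite -hdist_support -XD; apply: in_imfset2 => //.
by rewrite inE yX; apply: contraNneq xy => ->.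
Qed.

Lemma max_code_ge n (D : {fset nat}) (X : {set {set 'I_n}}) :
    {in X &, forall x y, x != y -> sdist x y \in D} ->
    (forall d, d \in D -> exists x y, [/\ x \in X, y \in X, x != y & sdist x y = d]) ->
  #|X| <= max_code n D.
Proof.
move=> XD DX; rewrite -(card_imset X (can_inj (@support_char_row n))).
apply: (@leq_bigmax_cond _ _ (fun X : {set 'rV['F_2]_n} => #|X|)).
apply/eqP/fsetP=> d; apply/(imfset2P _ _ _ _)/idP => [[_ /imsetP[x xX ->]]|].
  move=> [y]; rewrite inE => /andP[/imsetP[z zX ->] xz] ->.
  rewrite hdist_support !support_char_row XD //.
  by apply: contraNneq xz => ->.
move=> /DX[x [y [xX yX xy <-]]].
exists (char_row x); first by rewrite imset_f.
exists (char_row y); last by rewrite hdist_support !support_char_row.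
rewrite inE imset_f //=; apply: contraNneq xy => E.
by rewrite -(support_char_row x) E support_char_row.
Qed.

Lemma even_distsP t d : reflect (exists2 i, 0 < i <= t & d = i.*2) (d \in even_dists t).
Proof.
rewrite /even_dists; apply: (iffP (imfsetP _ _ _ _)) => -[i] /=; rewrite ?mem_iota => ti ->.
  by exists i; rewrite ?mul2n //; lia.
by exists i; rewrite ?mul2n //= mem_iota; lia.
Qed.

Lemma card_ord_interval n a b : a <= b <= n -> #|[set j : 'I_n | a <= j < b]| = b - a.
Proof.
move=> abn; rewrite cardsE -sum1_card.
rewrite -(big_mkord (fun j => a <= j < b) (fun=> 1)) big_mkcond /=.
suff -> m : \sum_(0 <= j < m) (if a <= j < b then 1 else 0) = minn b m - minn a m by lia.
elim: m => [|m IHm]; first by rewrite big_geq ?minn0.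
by rewrite big_nat_recr //= IHm; case: ifP; lia.
Qed.

(** * The distances 2, 4, .., 2t *)

Lemma sum_bin_parity (n t : nat) :
  \sum_(0 <= i < t.+1) 'C(n, i) =
  \sum_(0 <= i < t.+1 | i == t %[mod 2]) 'C(n.+1, i).
Proof.
have [k] := ubnP t; elim: k t => // k IHk [|[|t]] tk.
- by rewrite [RHS]big_mkcond !big_nat1 !bin0.
- by rewrite [RHS]big_mkcond /index_iota /= !big_cons !big_nil /= !bin0 !bin1 !addn0 add1n.
rewrite [RHS]big_mkcond /= !(big_nat_recr t.+2) // !(big_nat_recr t.+1) //=.
have mod2 i : (i == t.+2 %[mod 2]) = (i == t %[mod 2]) by rewrite !modn2 /= negbK.
under [in RHS]eq_bigr do rewrite mod2.
rewrite -big_mkcond /= -IHk; last by move: tk; clear; lia.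
have -> : t.+1 == t.+2 %[mod 2] = false by rewrite mod2 !modn2 /=; case: (odd t).
by rewrite eqxx binS; lia.
Qed.

(** Deleting one coordinate is injective on a family with positive even
distances and does not increase its diameter, so Kleitman's theorem applies in
dimension [n - 1]; summing its bound with Pascal's rule leaves the layers of the
parity of [t].  Those layers form an optimal family. *)
Theorem max_code_even t n : t.*2.+2 <= n ->
  max_code n (even_dists t) = \sum_(0 <= i < t.+1 | i == t %[mod 2]) 'C(n, i).
Proof.
move=> tn; apply/eqP; rewrite eqn_leq; apply/andP; split.
  rewrite -[max_code _ _]mul1n; apply: max_code_le => X XD; rewrite mul1n.
  case: n => // m in tn X XD *.
  rewrite -sum_bin_parity.
  have inj : {in X &, injective (fun x => x :\ ord0)}.
    move=> x y xX yX E; apply/eqP; apply: contraT => xy.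
    have /even_distsP[i it dE] := XD _ _ xX yX xy.
    have /andP[_] := sdist_setD1 ord0 x y.
    by rewrite E dE sdistxx; move: it; clear; lia.
  have cardS : #|[set~ ord0 : 'I_m.+1]| = m by rewrite cardsC1 card_ord.
  rewrite -(card_in_imset inj) -(eq_bigr _ (fun i _ => congr1 (binomial^~ i) cardS)).
  apply: kleitman; last by rewrite cardS.
    apply/subsetP=> _ /imsetP[x xX ->]; rewrite inE.
    by apply/subsetP=> j; rewrite !inE => /andP[].
  move=> _ _ /imsetP[x xX ->] /imsetP[y yX ->].
  have [->|xy] := eqVneq x y; first by rewrite sdistxx.
  have /andP[le _] := sdist_setD1 ord0 x y; apply: leq_ltn_trans le _.
  by have /even_distsP[i it ->] := XD _ _ xX yX xy; move: it; clear; lia.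
rewrite -[in leqLHS](card_ord n) -cardsT -(card_subsets _ (fun i => i == t %[mod 2])).
apply: max_code_ge => [x y|d /even_distsP[i it ->]].
  rewrite !in_set => /and3P[_ /eqP xt xle] /and3P[_ /eqP yt yle] xy.
  have half a b k s : a = t %[mod 2] -> b = t %[mod 2] -> a <= t -> b <= t ->
      s + k.*2 = a + b -> 0 < s -> 0 < s./2 <= t /\ s = s./2.*2.
    by clear; lia.
  have [st sE] := half _ _ _ _ xt yt xle yle (sdistD x y) (sdist_gt0 xy).
  by apply/even_distsP; exists (sdist x y)./2.
(* two intervals of length [t] sharing [t - i] points realize the distance [2i] *)
pose A := [set j : 'I_n | 0 <= j < t]; pose B := [set j : 'I_n | i <= j < t + i].
have cA : #|A| = t by rewrite card_ord_interval ?subn0; lia.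
have cB : #|B| = t by rewrite card_ord_interval; lia.
have cAB : #|A :&: B| = t - i.
  rewrite -(card_ord_interval (n := n)); last by lia.
  by apply: eq_card => j; rewrite !inE; lia.
have dAB : sdist A B = i.*2 by have := sdistD A B; rewrite cA cB cAB; lia.
exists A, B; split=> //; rewrite ?inE ?subsetT ?cA ?cB ?eqxx ?leqnn //.
apply/eqP=> AB; move: cAB; rewrite AB setIid cB; lia.
Qed.

(** * Distance sets other than 2, 4, .., 2t *)

Lemma prod_decreasing (B : seq nat) :
    sorted gtn B -> all (leq 1) B ->
  (size B <= head 0 B) && ((size B)`! <= \prod_(b <- B) b).
Proof.
elim: B => [|r B IHB] /=; first by rewrite big_nil.
move=> rB /andP[r_gt0 B_gt0]; have /andP[headB prodB] := IHB (path_sorted rB) B_gt0.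
have rs : size B < r.
  by case: B rB headB {IHB B_gt0 prodB} => //= b B /andP[br _] /leq_ltn_trans; apply.
by rewrite rs big_cons factS leq_mul.
Qed.

(** The improvement by the factor [(s + 1) / s] over [s!] comes from the largest
element: either it is at least [s + 1] instead of [s], or it equals [s] and the
gap is in the rest, where induction gives the even better factor
[s / (s - 1)]. *)
Lemma prod_decreasing_gap (B : seq nat) :
    sorted gtn B -> all (leq 1) B -> B <> rev (iota 1 (size B)) ->
  (size B).+1 * (size B)`! <= size B * \prod_(b <- B) b.
Proof.
elim: B => [|r B IHB] //= rB /andP[r_gt0 B_gt0] neq.
have sB := path_sorted rB.
have /andP[/= rs _] := @prod_decreasing (r :: B) rB (introT andP (conj r_gt0 B_gt0)).
have /andP[_ prodB] := prod_decreasing sB B_gt0.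
move: neq; rewrite big_cons factS; set s := size B in rs prodB *; move=> neq.
have [E|rs2] := eqVneq r s.+1; last first.
  have {}rs2 : s.+2 <= r by rewrite ltn_neqAle eq_sym rs2.
  by rewrite mulnCA leq_mul2l leq_mul.
have Bneq : B <> rev (iota 1 s).
  move=> EB; apply: neq; rewrite E EB.
  by rewrite -[RHS]/(rev (iota 1 s.+1)) -addn1 iotaD rev_cat addnC.
have arith p f P : p.+1 * f <= p * P -> p.+2 * (p.+1 * f) <= p.+1 * (p.+1 * P).
  case: p => [|p] H; first by move: H; rewrite mul0n mul1n leqn0 => /eqP->.
  rewrite -(leq_pmul2l (ltn0Sn p)).
  have : p.+2 * p.+2 * (p.+2 * f) <= p.+2 * p.+2 * (p.+1 * P).
    by rewrite leq_mul2l H orbT.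
  by clear; nia.
by rewrite E; apply: arith; apply: IHB.
Qed.

Lemma expn_le_ffact n t : n * n ^ t <= n * n ^_ t + t * t * n ^ t.
Proof.
elim: t => [|t IHt]; first by rewrite ffactn0 expn0 leq_addr.
rewrite ffactnSr.
have le1 : n ^_ t <= n ^ t.
  elim: (t) => [|k IHk]; first by rewrite ffactn0 expn0.
  by rewrite ffactnSr expnSr leq_mul ?leq_subr.
have le2 : n * (n * n ^_ t) <= n * (n ^_ t * (n - t)) + n * (t * n ^ t).
  rewrite -mulnDr leq_mul2l; apply/orP; right.
  have : t * n ^_ t <= t * n ^ t by rewrite leq_mul2l le1 orbT.
  have : n * n ^_ t <= (n - t + t) * n ^_ t by rewrite leq_mul2r; lia.
  by rewrite mulnDl [_ * (n - t)]mulnC; lia.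
have : n * (n * n ^ t) <= n * (n * n ^_ t + t * t * n ^ t) by rewrite leq_mul2l IHt orbT.
rewrite mulnDr expnS; move: le2; clear.
set x := _ * (_ * _ ^ _); set z := n ^ t; rewrite -/z => A B.
apply: leq_trans B _; nia.
Qed.

Lemma expn_le_ffact2 n t : t.*2 <= n -> n ^ t <= 2 ^ t * n ^_ t.
Proof.
elim: t => [|t IHt] tn; first by rewrite ffactn0 expn0.
rewrite ffactnSr !expnSr mulnACA leq_mul ?IHt //; lia.
Qed.

Definition halves (D : {fset nat}) : seq nat :=
  sort geq [seq d./2 | d <- enum_fset D & ~~ odd d].

Lemma mem_halves D b : (b \in halves D) = (b.*2 \in D).
Proof.
rewrite mem_sort; apply/mapP/idP => [[d]|bD].
  by rewrite mem_filter => /andP[/even_halfK dK dD] ->; rewrite dK.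
by exists b.*2; rewrite ?doubleK // mem_filter odd_double.
Qed.

Lemma halves_sorted D : sorted gtn (halves D).
Proof.
have geq_total : total geq by move=> a b; apply: leq_total.
rewrite gtn_sorted_uniq_geq sort_sorted // andbT sort_uniq.
rewrite map_inj_in_uniq ?filter_uniq ?fset_uniq // => a b.
rewrite !mem_filter => /andP[/even_halfK aK _] /andP[/even_halfK bK _] E.
by rewrite -aK -bK E.
Qed.

Lemma size_halves D : size (halves D) = count (fun d => ~~ odd d) (enum_fset D).
Proof. by rewrite size_sort size_map size_filter. Qed.

Lemma half_dists_parity n (D : {fset nat}) (X : {set {set 'I_n}}) (b : bool) :
    {in X &, forall x y, x != y -> sdist x y \in D} ->
  half_dists (halves D) [set x in X | odd #|x| == b].
Proof.
move=> XD x y; rewrite !in_set => /andP[xX /eqP xb] /andP[yX /eqP yb] xy.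
have dK : (sdist x y)./2.*2 = sdist x y.
  rewrite even_halfK //; have := congr1 odd (sdistD x y).
  by rewrite !oddD odd_double addbF xb yb addbb => ->.
by rewrite -dK map_f // mem_halves dK; apply: XD.
Qed.

(** If some distance is odd, each of the two parity classes has fewer than [t]
distances, all even, so the family is of lower order.  Otherwise the half
distances have product at least [(t + 1) / t * t!]. *)
Theorem max_code_bound (D : {fset nat}) (t : nat) :
    (forall d, d \in D -> 0 < d) -> #|` D|%fset = t -> D <> even_dists t ->
  exists K, forall n, t.*2 <= n ->
    n * max_code n D * t.+1 <= (n * t + K) * 'C(n, t).
Proof.
move=> D_gt0 Dt Dneq.
have B_gt0 : all (leq 1) (halves D).
  by apply/allP=> b; rewrite mem_halves => /D_gt0; rewrite double_gt0.
have [C bound] := card_half_dists (halves_sorted D) B_gt0.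
have size_le : size (halves D) <= t.
  by rewrite size_halves -Dt; apply: count_size.
have [sizeB|size_neq] := eqVneq (size (halves D)) t; last first.
  have {size_neq size_le} size_lt : size (halves D) < t by rewrite ltn_neqAle size_neq.
  exists (2 * C.+1 * 2 ^ t * t`! * t.+1) => n tn.
  have small : n * max_code n D <= 2 * C.+1 * n ^ t.
    apply: max_code_le => X XD.
    have class b : n * #|[set x in X | odd #|x| == b]| <= C.+1 * n ^ t.
      have [n0|n_gt0] := posnP n; first by rewrite [X in X * _]n0.
      have := bound _ _ (half_dists_parity (b := b) XD); rewrite card_ord.
      set P := \prod_(_ <- _) _ => H.
      have P_gt0 : 0 < P.
        by rewrite /P big_seq prodn_cond_gt0 // => c; exact: (allP B_gt0).
      apply: leq_trans (_ : n * P * #|[set x in X | odd #|x| == b]| <= _).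
        by rewrite -mulnA leq_mul2l leq_pmull ?orbT.
      apply: leq_trans H _; rewrite mulSn leq_add ?leq_mul2l ?leq_pexp2l ?orbT //.
      exact: ltnW.
    have -> : #|X| = #|[set x in X | odd #|x| == true]| + #|[set x in X | odd #|x| == false]|.
      rewrite -(cardsID [set x : {set 'I_n} | odd #|x|] X); congr (_ + _); apply: eq_card => x.
        by rewrite !in_set eqb_id.
      by rewrite !in_set eqbF_neg andbC.
    by rewrite mulnDr -mulnA mul2n -addnn leq_add.
  apply: leq_trans (_ : 2 * C.+1 * n ^ t * t.+1 <= _); first by rewrite leq_mul2r small orbT.
  apply: leq_trans (_ : 2 * C.+1 * (2 ^ t * (t`! * 'C(n, t))) * t.+1 <= _).
    by rewrite leq_mul2r leq_mul2l [t`! * _]mulnC bin_ffact expn_le_ffact2 ?orbT.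
  by rewrite [leqRHS]mulnDl; apply: leq_trans (leq_addl _ _); apply: eq_leq; ring.
have Deven d : d \in D -> ~~ odd d.
  have /allP : all (fun d => ~~ odd d) (enum_fset D).
    by rewrite all_count -size_halves sizeB -Dt.
  exact.
have halvesE : halves D <> rev (iota 1 t).
  move=> E; apply: Dneq; apply/fsetP=> d; apply/idP/even_distsP => [dD|[i it ->]].
    exists d./2; last by rewrite even_halfK // Deven.
    have : d./2 \in halves D by rewrite mem_halves even_halfK // Deven.
    by rewrite E mem_rev mem_iota; clear; lia.
  by rewrite -mem_halves E mem_rev mem_iota; move: it; clear; lia.
have := prod_decreasing_gap (halves_sorted D) B_gt0; rewrite sizeB => /(_ halvesE).
rewrite sizeB in bound; move: bound; set P := \prod_(_ <- _) _ => bound gap.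
pose K := (t * t + C) * 2 ^ t.
exists (t * K) => n tn.
have upper : n * P * max_code n D <= (n + K) * (t`! * 'C(n, t)).
  apply: max_code_le => X XD; rewrite [t`! * _]mulnC bin_ffact.
  have := bound _ X; rewrite card_ord => /(_ _)/leq_trans; apply.
    move=> x y xX yX xy; have dD := XD x y xX yX xy.
    by rewrite -(even_halfK (Deven _ dD)) map_f // mem_halves even_halfK // Deven.
  rewrite expnS; apply: leq_trans (leq_add (expn_le_ffact n t) (leqnn _)) _.
  rewrite -addnA -mulnDl [leqRHS]mulnDl leq_add2l /K -mulnA leq_mul2l.
  by rewrite expn_le_ffact2 ?orbT.
rewrite -(leq_pmul2l (fact_gt0 t)).
apply: leq_trans (_ : t * (n * P * max_code n D) <= _).
  rewrite (_ : t`! * _ = n * max_code n D * (t.+1 * t`!)); last by ring.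
  rewrite (_ : t * _ = n * max_code n D * (t * P)); last by ring.
  by rewrite leq_mul2l gap orbT.
apply: leq_trans (_ : t * ((n + K) * (t`! * 'C(n, t))) <= _).
  by rewrite leq_mul2l upper orbT.
by apply: eq_leq; ring.
Qed.

(** * The asymptotic statement *)

From mathcomp Require Import all_classical all_reals all_analysis.
Import Order.TTheory GRing.Theory Num.Theory.
Import numFieldNormedType.Exports.

Local Open Scope classical_set_scope.
Local Open Scope ring_scope.

Theorem theorem1p4 (R : realType) (t : nat) (t_gt0 : (0 < t)%N) :
  (forall D : {fset nat},
     (forall d, d \in D -> (0 < d)%N) ->
     #|` D|%fset = t ->
     D <> even_dists t ->
     exists u : nat -> R,
       u @ \oo --> (0 : R) /\
       \forall n \near \oo,
         (max_code n D)%:R <= (t%:R / t.+1%:R + u n) * 'C(n, t)%:R :> R)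
  /\
  (forall n : nat, (2 * t + 2 <= n)%N ->
     max_code n (even_dists t) =
       (\sum_(0 <= i < t.+1 | i == t %[mod 2]) 'C(n, i))%N).
Proof.
split=> [D D_gt0 Dt Dneq|n tn]; last by apply: max_code_even; rewrite -mul2n -addn2.
have [K bound] := max_code_bound D_gt0 Dt Dneq.
exists (fun n => K%:R / t.+1%:R / n%:R); split.
  rewrite -(cvg_shiftS (fun n => K%:R / t.+1%:R / n%:R : R)).
  have : (fun n => K%:R / t.+1%:R * harmonic n : R) @ \oo --> (K%:R / t.+1%:R * 0 : R).
    by apply: cvgMr; apply: cvg_harmonic.
  by rewrite mulr0.
near=> n.
have tn : (t.*2 <= n)%N by near: n; exact: nbhs_infty_ge.
have n_gt0 : (0 < n)%N by apply: leq_trans tn; rewrite double_gt0.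
have n0 : (n%:R : R) != 0 by rewrite pnatr_eq0 -lt0n.
rewrite (_ : _ * _ = ((n * t + K) * 'C(n, t))%:R / (n * t.+1)%:R); last first.
  by rewrite !natrM natrD natrM /=; field; rewrite n0 nat1r pnatr_eq0.
rewrite ler_pdivlMr; last by rewrite ltr0n muln_gt0 n_gt0.
by rewrite -natrM ler_nat mulnCA mulnA bound.
Unshelve. all: by end_near.
Qed.
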